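(* The primal traffic assignment problem (TAP), namely: minimize $$Z(\boldsymbol{x})=\sum_{(i,j)\in\mathcal E}\sum_{w\in\mathcal W}\left[\int_0^{\sum_{w'\in\mathcal W}q^{w'}x_{ij}^{w'}}c_{ij}^w(t_{ij}(m))\,dm+q^wF_{ij}^w(x_{ij}^w)\right]$$ over $\boldsymbol{x}=(x_{ij}^w)_{(i,j)\in\mathcal E,w\in\mathcal W}$ subject to $x_{ij}^w\ge 0$ for all $(i,j)\in\mathcal E,w\in\mathcal W$ and $q^w(A_v\boldsymbol{x}^w-b_v^w)=0$ for all $v\in\mathcal V,w\in\mathcal W$ (where $\boldsymbol{x}^w=(x_{ij}^w)_{(i,j)\in\mathcal E}$), admits a unique solution.
   Context: Network: $(\mathcal V,\mathcal E)$ is a finite directed network with node set $\mathcal V$ and set of directed links $\mathcal E$; it is connected, meaning that there is at least one (directed) path between any two nodes. The node-link incidence matrix $A\in\mathbb R^{|\mathcal V|\times|\mathcal E|}$ has entries $a_{v,ij}=-1$ if $v=i$, $a_{v,ij}=1$ if $v=j$, and $0$ otherwise; $A_v$ is its row for node $v$. Types: $\mathcal W$ is a finite set of traveler types; type $w$ has volume $q^w>0$, an origin, a destination $d^w$, and a unit demand vector $b^w\in\mathbb R^{|\mathcal V|}$ with $b^w_v=-1$ if $v$ is the origin, $b^w_v=1$ if $v$ is the destination, $0$ otherwise. Perturbation functions: for each link $(i,j)$ and type $w$, $F_{ij}^w:\mathbb R_+\to\mathbb R_+$ is continuously differentiable, strictly convex, strictly increasing, with $F_{ij}^w(0)=(F_{ij}^w)'(0)=0$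 and range $\mathbb R_+$. The inverse $(F_{ij}^{w\prime})^{-1}$ of the derivative is extended by $(F_{ij}^{w\prime})^{-1}(y)=0$ for $y<0$, so that it has domain equal to $\mathbb R$ (in particular $(F_{ij}^w)'$ maps $\mathbb R_+$ onto $\mathbb R_+$). Travel times and costs: $t_{ij}:\mathbb R_+\to\mathbb R_+$ (link travel time as a function of link flow) is positive, differentiable, increasing and strictly convex, with $t_{ij}>0$, $t_{ij}'>0$. The link cost $c_{ij}^w:\mathbb R_+\to\mathbb R_+$ (a function of link travel time) is positive, continuously differentiable, increasing and convex, with $c_{ij}^w(0)>0$, ${c_{ij}^w}'>0$. *)

(* Defs.v *)
From HB Require Import structures.
From mathcomp Require Import all_boot all_order all_algebra.
From mathcomp Require Import all_classical all_reals all_analysis.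

Set Implicit Arguments.
Unset Strict Implicit.
Unset Printing Implicit Defensive.

Import Order.TTheory GRing.Theory Num.Theory.
Import numFieldNormedType.Exports.

Local Open Scope classical_set_scope.
Local Open Scope ring_scope.

(* A function R_+ -> R_+ is a function R -> R of which only the values on
   [nonnegR] matter: every condition below is relative to [nonnegR]. *)
Definition nonnegR (R : realType) : set R := `[0, +oo[.
Arguments nonnegR {R}.

(* Derivative relative to R_+: the usual derivative at x > 0, the right
   derivative at 0, so that f is never evaluated outside R_+. *)
Definition diff_quot (R : realType) (f : R -> R) (x y : R) : R :=
  (y - x)^-1 * (f y - f x).

Definition derivable_nonneg (R : realType) (f : R -> R) (x : R) : Prop :=
  cvg (diff_quot f x y @[y --> within nonnegR x^']).

Definition deriv_nonneg (R : realType) (f : R -> R) (x : R) : R :=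
  lim (diff_quot f x y @[y --> within nonnegR x^']).

Definition strictly_convex_nonneg (R : realType) (f : R -> R) : Prop :=
  {in nonnegR &, forall x y : R, x != y -> forall p : R, 0 < p < 1 ->
    f (p * x + (1 - p) * y) < p * f x + (1 - p) * f y}.

Definition strictly_increasing_nonneg (R : realType) (f : R -> R) : Prop :=
  {in nonnegR &, {homo f : x y / x < y}}.

Definition convex_nonneg (R : realType) (f : R -> R) : Prop :=
  convex_function (nonnegR : set (convex_lmodType R^o)) f.

(* The two [range] fields are set equalities: they say both that the function
   is R_+-valued and that it is onto R_+. *)
Record perturbation_function (R : realType) (F : R -> R) : Prop := {
  perturbation_derivable : {in nonnegR, forall x, derivable_nonneg F x};
  perturbation_C1 : {within nonnegR, continuous (deriv_nonneg F)};
  perturbation_convex : strictly_convex_nonneg F;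
  perturbation_increasing : strictly_increasing_nonneg F;
  perturbation0 : F 0 = 0;
  perturbation_deriv0 : deriv_nonneg F 0 = 0;
  perturbation_range : F @` nonnegR = nonnegR;
  perturbation_deriv_range : deriv_nonneg F @` nonnegR = nonnegR
}.

Record travel_time_function (R : realType) (t : R -> R) : Prop := {
  travel_time_gt0 : {in nonnegR, forall m, 0 < t m};
  travel_time_derivable : {in nonnegR, forall m, derivable_nonneg t m};
  travel_time_increasing : strictly_increasing_nonneg t;
  travel_time_convex : strictly_convex_nonneg t;
  travel_time_deriv_gt0 : {in nonnegR, forall m, 0 < deriv_nonneg t m}
}.

Record link_cost_function (R : realType) (c : R -> R) : Prop := {
  link_cost_gt0 : {in nonnegR, forall s, 0 < c s};
  link_cost_derivable : {in nonnegR, forall s, derivable_nonneg c s};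
  link_cost_C1 : {within nonnegR, continuous (deriv_nonneg c)};
  link_cost_increasing : strictly_increasing_nonneg c;
  link_cost_convex : convex_nonneg c;
  link_cost_deriv_gt0 : {in nonnegR, forall s, 0 < deriv_nonneg c s}
}.

Definition link (V : finType) (E : {set V * V}) : finType :=
  {e : V * V | e \in E}.

Definition connected_network (V : finType) (E : {set V * V}) : Prop :=
  forall u v : V, connect (fun i j => (i, j) \in E) u v.

(* -1 at i, 1 at j, 0 elsewhere when i <> j; a loop (i, i) gets the null
   column. *)
Definition incidence (R : realType) (V : finType) (E : {set V * V})
    (v : V) (e : link E) : R :=
  (v == (val e).2)%:R - (v == (val e).1)%:R.

(* -1 at the origin o, 1 at the destination d, 0 elsewhere when o <> d. *)
Definition demand (R : realType) (V : finType) (o d v : V) : R :=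
  (v == d)%:R - (v == o)%:R.

(* x e w is the flow share of type w on link e. *)
Definition TAP_objective (R : realType) (V W : finType) (E : {set V * V})
    (q : W -> R) (F : link E -> W -> R -> R) (t : link E -> R -> R)
    (c : link E -> W -> R -> R) (x : link E -> W -> R) : R :=
  \sum_(e : link E) \sum_(w : W)
    (\int[lebesgue_measure]_(m in `[0, \sum_(w' : W) q w' * x e w'])
        c e w (t e m)
     + q w * F e w (x e w)).

Definition TAP_feasible (R : realType) (V W : finType) (E : {set V * V})
    (q : W -> R) (orig dest : W -> V) (x : link E -> W -> R) : Prop :=
  (forall e w, 0 <= x e w) /\
  (forall v w, q w * (\sum_(e : link E) incidence R v e * x e w
                      - demand R (orig w) (dest w) v) = 0).

Definition TAP_solution (R : realType) (V W : finType) (E : {set V * V})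
    (q : W -> R) (orig dest : W -> V) (F : link E -> W -> R -> R)
    (t : link E -> R -> R) (c : link E -> W -> R -> R)
    (x : link E -> W -> R) : Prop :=
  TAP_feasible q orig dest x /\
  forall y : link E -> W -> R, TAP_feasible q orig dest y ->
    TAP_objective q F t c x <= TAP_objective q F t c y.

(* Main.v *)
(** Existence: the flow along one path per type is feasible, with objective M
    say.  All terms of the objective are nonnegative and F_e^w is onto R_+, so
    feasible points with objective at most M have x_e^w <= b where
    F_e^w(b) = M / q^w.  They lie in a compact set, on which the continuous
    objective attains its minimum.
    Uniqueness: c(t(m)) is nondecreasing in m, so its integral is convex, while
    F_e^w is strictly convex; the midpoint of two distinct solutions would have
    a strictly smaller objective. *)
Require Import Defs.
From HB Require Import structures.
From mathcomp Require Import all_boot all_order all_algebra.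
From mathcomp Require Import all_classical all_reals all_analysis.
From mathcomp Require Import lra ring.
Import Order.TTheory GRing.Theory Num.Theory.
Import numFieldNormedType.Exports.

Local Open Scope classical_set_scope.
Local Open Scope ring_scope.

(** * Continuity of functions differentiable on R_+ *)

Lemma in_nonnegR (R : realType) (x : R) : (x \in @nonnegR R) = (0 <= x).
Proof.
by apply/idP/idP; rewrite inE /nonnegR /= in_itv /= andbT.
Qed.

(* Composing with [Num.max 0] replaces f by a function that is continuous on
   the whole line and does not depend on the values of f at negative reals. *)
Lemma derivable_nonneg_continuous (R : realType) (f : R -> R) :
  {in nonnegR, forall x, derivable_nonneg f x} ->
  continuous (fun x : R => f (Num.max 0 x)).
Proof.
move=> df x0; set a := Num.max 0 x0.
have a_ge0 : 0 <= a by rewrite le_max lexx.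
have /df/cvg_ex[l dl] : a \in @nonnegR R by rewrite in_nonnegR.
have fa : f y @[y --> within nonnegR a^'] --> f a.
  have Ga : within nonnegR a^' --> a by move=> U; apply: filterS => y Uy _ _.
  (* For y != a, f y equals the difference quotient times y - a, plus f a; the quotient has the
     finite limit l, so f y tends to f a. *)
  have : (diff_quot f a y * (y - a) + f a) @[y --> within nonnegR a^'] -->
      l * (a - a) + f a.
    move: (within _ _) (within_filter nonnegR (dnbhs_filter a)) dl Ga.
    move=> G FG dl Ga.
    apply: cvgD; last exact: cvg_cst.
    by apply: cvgM => //; apply: cvgB => //; exact: cvg_cst.
  rewrite subrr mulr0 add0r; apply: cvg_trans; apply: near_eq_cvg.
  apply: (@filterE _ (nbhs a)) => y ya _.
  by rewrite /diff_quot mulrAC mulVf ?mul1r ?subrK// subr_eq0.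
have max_cont : Num.max 0 x @[x --> x0] --> a.
  by apply: (@continuous_max _ _ (cst 0) id); [exact: cvg_cst | exact: cvg_id].
move=> U Ua; have Ufa := nbhs_singleton Ua.
have /max_cont := fa _ Ua; apply: (@filterS _ (nbhs x0)) => x /= Ux.
(* The limit [fa] ignores the point a itself, yet [Num.max 0 x] takes the value a at x0, and at
   every x <= 0 when a = 0. *)
have [->//|xa] := eqVneq (Num.max 0 x) a.
by apply: Ux => //; rewrite /nonnegR /= in_itv /= andbT le_max lexx.
Qed.

(** * Primitives of continuous nondecreasing functions *)

(** Between s and u the integrand is at least k s if s <= u and at most k s if u <= s; comparing
    with the integral of the constant gives the bound in both cases. Thus k s is a subgradient of
    the primitive at s, from which its convexity and continuity follow. *)
Lemma Rintegral_subgradient (R : realType) (k : R -> R) (s u : R) :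
  continuous k -> {homo k : x y / x <= y} -> 0 <= s -> 0 <= u ->
  k s * (u - s) <= \int[lebesgue_measure]_(m in `[0, u]) k m -
                   \int[lebesgue_measure]_(m in `[0, s]) k m.
Proof.
move=> ck mk s0 u0.
set H := fun z : R => \int[lebesgue_measure]_(m in `[0, z]) k m.
rewrite -/(H u) -/(H s).
have ik a b : lebesgue_measure.-integrable `[a, b] (EFin \o k).
  apply: continuous_compact_integrable; first exact: segment_compact.
  exact: continuous_subspaceT.
(* Half-open intervals occur because [[0, b]] minus [[0, a]] is []a, b]]. *)
have io a b : lebesgue_measure.-integrable `]a, b] (EFin \o k).
  by apply: integrableS (ik a b) => //; exact: subset_itv_oc_cc.
have ic a b r : lebesgue_measure.-integrable `]a, b] (EFin \o cst (r : R)).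
  have ir : lebesgue_measure.-integrable `[a, b] (EFin \o cst (r : R)).
    apply: continuous_compact_integrable; first exact: segment_compact.
    by apply: continuous_subspaceT; exact: cst_continuous.
  by apply: integrableS ir => //; exact: subset_itv_oc_cc.
have HB a b : 0 <= a -> a <= b ->
    H b - H a = \int[lebesgue_measure]_(m in `]a, b]) k m.
  by move=> a0 ab; rewrite /H Rintegral_itvB ?bnd_simp.
have cst_int a b r : a <= b ->
    \int[lebesgue_measure]_(m in `]a, b]) (cst r m) = r * (b - a) :> R.
  rewrite le_eqVlt => /orP[/eqP <-|ab]; rewrite Rintegral_cst//=.
    by rewrite lebesgue_measure_itv /= ltxx subrr /=.
  by rewrite lebesgue_measure_itv /= lte_fin ab.
have [su|/ltW us] := leP s u.
  rewrite HB // -cst_int //; apply: le_Rintegral => //.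
  by move=> x /=; rewrite in_itv /= => /andP[/ltW sx _]; exact: mk.
rewrite -lerN2 opprB HB // -mulrN opprB -cst_int //; apply: le_Rintegral => //.
by move=> x /=; rewrite in_itv /= => /andP[_ xs]; exact: mk.
Qed.

Lemma Rintegral_continuous (R : realType) (k : R -> R) :
  continuous k -> {homo k : x y / x <= y} ->
  continuous (fun z : R => \int[lebesgue_measure]_(m in `[0, Num.max 0 z]) k m).
Proof.
move=> ck mk x0.
set H := fun z : R => \int[lebesgue_measure]_(m in `[0, z]) k m.
set a := Num.max 0 x0.
have a0 : 0 <= a by rewrite le_max lexx.
have ca : Num.max 0 x @[x --> x0] --> a.
  by apply: (@continuous_max _ _ (cst 0) id); [exact: cvg_cst | exact: cvg_id].
have cka : k (Num.max 0 x) @[x --> x0] --> k a by exact: (cvg_comp _ _ ca (ck a)).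
have caB : (Num.max 0 x - a) @[x --> x0] --> 0.
  by rewrite -[X in _ --> X](subrr a); apply: cvgB => //; exact: cvg_cst.
(* The subgradient inequality at a and the one at u = max 0 x squeeze H u. *)
change (H (Num.max 0 x) @[x --> x0] --> H a).
apply: (@squeeze_cvgr _ _ _ _ (fun x => H a + k a * (Num.max 0 x - a))
  (fun x => H a + k (Num.max 0 x) * (Num.max 0 x - a))).
- near=> x; set u := Num.max 0 x.
  have u0 : 0 <= u by rewrite le_max lexx.
  have := @Rintegral_subgradient _ _ _ _ ck mk a0 u0.
  have := @Rintegral_subgradient _ _ _ _ ck mk u0 a0.
  rewrite -/(H u) -/(H a) -opprB => h1 h2; apply/andP; split; lra.
- rewrite -[X in _ --> X]addr0 -[X in _ --> _ + X](mulr0 (k a)).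
  by apply: cvgD; [exact: cvg_cst | apply: cvgM => //; exact: cvg_cst].
- rewrite -[X in _ --> X]addr0 -[X in _ --> _ + X](mulr0 (k a)).
  by apply: cvgD; [exact: cvg_cst | exact: cvgM].
Unshelve. all: by end_near. Qed.

(** * Continuity of finite sums *)

Lemma continuous_sum (R : realType) (T : topologicalType) (I : Type)
    (r : seq I) (f : I -> T -> R) :
  (forall i, continuous (f i)) -> continuous (fun x => \sum_(i <- r) f i x).
Proof.
move=> cf; elim: r => [|i r IH] x.
  by under eq_fun do rewrite big_nil; exact: cvg_cst.
under eq_fun do rewrite big_cons.
by apply: cvgD; [exact: cf | exact: IH].
Qed.

Lemma continuous_mull (R : realType) (T : topologicalType) (a : R)
    (f : T -> R) :
  continuous f -> continuous (fun x => a * f x).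
Proof.
by move=> cf x; apply: (@continuousM _ _ (cst a) f); [exact: cvg_cst | exact: cf].
Qed.

Lemma continuous_linear_combination (R : realType) (T : topologicalType)
    (I : Type) (r : seq I) (a : I -> R) (f : I -> T -> R) :
  (forall i, continuous (f i)) ->
  continuous (fun x => \sum_(i <- r) a i * f i x).
Proof.
by move=> cf; apply: continuous_sum => i; apply: continuous_mull; exact: cf.
Qed.

(** * Unit flow along a path *)

(** The flow counts how often the path traverses each link, so the path need not be simple. Adding
    the first link (u, j) adds its incidence column, which is the demand from u to j, and demands
    telescope. *)
Lemma path_flow (R : realType) (V : finType) (E : {set V * V}) (u : V)
    (p : seq V) :
  path (fun i j => (i, j) \in E) u p ->
  exists2 f : link E -> R, forall e, 0 <= f e &
    forall v, \sum_e incidence R v e * f e = demand R u (last u p) v.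
Proof.
elim: p u => [|j p IH] u /=.
  move=> _; exists (fun=> 0) => // v.
  by rewrite big1 /demand ?subrr // => e _; rewrite mulr0.
move=> /andP[uj /IH[f f0 fE]].
pose e0 : link E := exist _ (u, j) uj.
exists (fun e => f e + (e == e0)%:R) => [e|v].
  by rewrite addr_ge0.
under eq_bigr do rewrite mulrDr.
rewrite big_split /= fE (bigD1 e0) //= eqxx mulr1 big1 => [|e /negPf->].
  by rewrite /demand /incidence /=; ring.
by rewrite mulr0.
Qed.

Section TAP.
Variables (R : realType) (V W : finType) (E : {set V * V}).
Variables (q : W -> R) (orig dest : W -> V).
Variables (F : link E -> W -> R -> R) (t : link E -> R -> R).
Variable (c : link E -> W -> R -> R).
Hypotheses (hE : connected_network E) (hq : forall w, 0 < q w).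
Hypotheses (hF : forall e w, perturbation_function (F e w)).
Hypotheses (ht : forall e, travel_time_function (t e)).
Hypotheses (hc : forall e w, link_cost_function (c e w)).

Lemma exists_feasible : exists x : link E -> W -> R, TAP_feasible q orig dest x.
Proof.
have flow w : exists f : link E -> R, (forall e, 0 <= f e) /\
    forall v, \sum_e incidence R v e * f e = demand R (orig w) (dest w) v.
  have /connectP[p pp ->] := hE (orig w) (dest w).
  by have [f f0 fE] := @path_flow R _ _ _ _ pp; exists f.
have [g gP] := choice flow.
exists (fun e w => g w e); split=> [e w|v w]; first exact: (gP w).1.
by rewrite (gP w).2 subrr mulr0.
Qed.

(** * Link costs as functions of flow, and the terms of the objective *)

(** Freezing the cost at its value at flow 0 for negative m makes it continuous, positive and
    nondecreasing on the whole line. *)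
Let cost e w m := c e w (t e (Num.max 0 m)).

Let cumul e w z := \int[lebesgue_measure]_(m in `[0, z]) c e w (t e m).

Let cost_gt0 e w m : 0 < cost e w m.
Proof.
have m0 : 0 <= Num.max 0 m by rewrite le_max lexx.
apply: (link_cost_gt0 (hc e w)); rewrite in_nonnegR ltW //.
by apply: (travel_time_gt0 (ht e)); rewrite in_nonnegR.
Qed.

Let cumulE e w z : cumul e w z = \int[lebesgue_measure]_(m in `[0, z]) cost e w m.
Proof.
apply: eq_Rintegral => m; rewrite inE /= in_itv /= => /andP[m0 _].
by rewrite /cost max_r.
Qed.

Let cost_homo e w : {homo cost e w : x y / x <= y}.
Proof.
move=> x y xy; have x0 z : Num.max 0 z \in @nonnegR R.
  by rewrite in_nonnegR le_max lexx.
have mxy : Num.max 0 x <= Num.max 0 y :> R by rewrite ge_max !le_max lexx xy orbT.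
move: mxy; rewrite le_eqVlt => /orP[/eqP mxy|mxy]; first by rewrite /cost mxy.
apply/ltW/(link_cost_increasing (hc e w)).
- by rewrite in_nonnegR ltW //; exact: (travel_time_gt0 (ht e)).
- by rewrite in_nonnegR ltW //; exact: (travel_time_gt0 (ht e)).
- exact: (travel_time_increasing (ht e)).
Qed.

Let cost_continuous e w : continuous (cost e w).
Proof.
have ct := derivable_nonneg_continuous _ _ (travel_time_derivable (ht e)).
have cc := derivable_nonneg_continuous _ _ (link_cost_derivable (hc e w)).
have -> : cost e w = (fun s => c e w (Num.max 0 s)) \o
    (fun m => t e (Num.max 0 m)).
  apply/funext => m /=; rewrite /cost [Num.max 0 (t e _)]max_r // ltW //.
  by apply: (travel_time_gt0 (ht e)); rewrite in_nonnegR le_max lexx.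
by move=> m; apply: continuous_comp; [exact: ct | exact: cc].
Qed.

Let cumul_continuous e w : continuous (fun z : R => cumul e w (Num.max 0 z)).
Proof.
under eq_fun do rewrite cumulE.
by apply: Rintegral_continuous; [exact: cost_continuous | exact: cost_homo].
Qed.

Let cumul_subgradient e w s u : 0 <= s -> 0 <= u ->
  cost e w s * (u - s) <= cumul e w u - cumul e w s.
Proof.
by rewrite !cumulE; apply: Rintegral_subgradient;
  [exact: cost_continuous | exact: cost_homo].
Qed.

Let cumul_ge0 e w s : 0 <= cumul e w s.
Proof.
by rewrite cumulE; apply: Rintegral_ge0 => m _; rewrite ltW.
Qed.

(** In the subgradient inequalities at the midpoint, towards s and towards u, the slope terms are
    opposite and cancel on adding. *)
Let cumul_midpoint e w s u : 0 <= s -> 0 <= u ->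
  cumul e w ((s + u) / 2) <= (cumul e w s + cumul e w u) / 2.
Proof.
move=> s0 u0; have m0 : 0 <= (s + u) / 2 by rewrite divr_ge0 ?addr_ge0.
have := cumul_subgradient e w _ _ m0 s0; have := cumul_subgradient e w _ _ m0 u0.
set k := cost _ _ _; set C := cumul e w; rewrite -!/(C _).
nra.
Qed.

Let perturbation_ge0 e w z : 0 <= z -> 0 <= F e w z.
Proof.
move=> z0; have := perturbation_range (hF e w).
move/seteqP => [/(_ (F e w z))]; rewrite /nonnegR /= in_itv /= andbT => + _.
by apply; exists z => //; rewrite in_itv /= z0.
Qed.

Let perturbation_continuous e w : continuous (fun z : R => F e w (Num.max 0 z)).
Proof.
by apply: derivable_nonneg_continuous; exact: perturbation_derivable (hF e w).
Qed.

Let total_ge0 (x : link E -> W -> R) e :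
  (forall e w, 0 <= x e w) -> 0 <= \sum_w q w * x e w.
Proof. by move=> x0; apply: sumr_ge0 => w _; rewrite mulr_ge0 // ltW. Qed.

(** This turns a bound on the objective into a bound on each single coordinate of the flow. *)
Let term_le_objective (x : link E -> W -> R) e w :
  (forall e w, 0 <= x e w) -> q w * F e w (x e w) <= TAP_objective q F t c x.
Proof.
move=> x0.
have t0 e' w' : 0 <= q w' * F e' w' (x e' w').
  by rewrite mulr_ge0 ?perturbation_ge0 // ltW.
have s0 e' w' : 0 <= cumul e' w' (\sum_w q w * x e' w) + q w' * F e' w' (x e' w').
  by rewrite addr_ge0.
rewrite /TAP_objective (bigD1 e) //= (bigD1 w) //=.
apply: ler_wpDr; first by apply: sumr_ge0 => e' _; apply: sumr_ge0 => w' _; exact: s0.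
apply: ler_wpDr; first by apply: sumr_ge0 => w' _; exact: s0.
by rewrite ler_wpDl // cumul_ge0.
Qed.

(** * Uniqueness by midpoint convexity *)

Lemma feasible_midpoint (x y : link E -> W -> R) :
  TAP_feasible q orig dest x -> TAP_feasible q orig dest y ->
  TAP_feasible q orig dest (fun e w => (x e w + y e w) / 2).
Proof.
move=> [x0 xA] [y0 yA]; split=> [e w|v w].
  by rewrite divr_ge0 ?addr_ge0.
have -> : \sum_e incidence R v e * ((x e w + y e w) / 2) =
    ((\sum_e incidence R v e * x e w) + (\sum_e incidence R v e * y e w)) / 2.
  by rewrite -big_split mulr_suml; apply: eq_bigr => e _ /=; ring.
have := xA v w; have := yA v w; lra.
Qed.

Lemma solution_unique (x y : link E -> W -> R) :
  TAP_solution q orig dest F t c x -> TAP_solution q orig dest F t c y -> x = y.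
Proof.
move=> [fx mx] [fy my]; pose z e w := (x e w + y e w) / 2.
have fz : TAP_feasible q orig dest z by exact: feasible_midpoint.
have Zxz := mx _ fz; have Zyz := my _ fz.
have [x0 _] := fx; have [y0 _] := fy.
pose T (x : link E -> W -> R) e w :=
  cumul e w (\sum_w q w * x e w) + q w * F e w (x e w).
(* The convexity defect of each term: positive where x and y differ, nonnegative elsewhere, while
   optimality of x and y makes the total at most 0. *)
pose gap e w := (T x e w + T y e w) / 2 - T z e w.
have Fmid e w : x e w != y e w ->
    F e w (z e w) < (F e w (x e w) + F e w (y e w)) / 2.
  move=> xy; have h : 0 < (2^-1 : R) < 1 by apply/andP; split; lra.
  have := @perturbation_convex _ _ (hF e w) _ _ _ _ xy _ h.
  rewrite !in_nonnegR => /(_ (x0 e w) (y0 e w)).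
  have -> : 2^-1 * x e w + (1 - 2^-1) * y e w = z e w by rewrite /z; field.
  lra.
have Cmid e w : cumul e w (\sum_w q w * z e w) <=
    (cumul e w (\sum_w q w * x e w) + cumul e w (\sum_w q w * y e w)) / 2.
  have -> : \sum_w q w * z e w =
      ((\sum_w q w * x e w) + \sum_w q w * y e w) / 2.
    rewrite -big_split mulr_suml; apply: eq_bigr => w' _ /=; rewrite /z; ring.
  by apply: cumul_midpoint; exact: total_ge0.
have gap_gt0 e w : x e w != y e w -> 0 < gap e w.
  move=> /Fmid; rewrite -(ltr_pM2l (hq w)) => h.
  have := Cmid e w; rewrite /gap /T; lra.
(* Where x and y agree the F parts cancel, but the total flows on e may still differ through other
   types, hence the use of [Cmid]. *)
have gap_ge0 e w : 0 <= gap e w.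
  have [xy|/gap_gt0/ltW//] := eqVneq (x e w) (y e w).
  have := Cmid e w; rewrite /gap /T.
  have -> : z e w = x e w by rewrite /z -xy; field.
  rewrite -xy; lra.
have sum_gap : \sum_e \sum_w gap e w <= 0.
  have -> : \sum_e \sum_w gap e w = (TAP_objective q F t c x +
      TAP_objective q F t c y) / 2 - TAP_objective q F t c z.
    rewrite /TAP_objective -big_split mulr_suml -sumrB; apply: eq_bigr => e _ /=.
    by rewrite -big_split mulr_suml -sumrB; apply: eq_bigr => w _.
  lra.
apply/funext => e; apply/funext => w; apply: contrapT => /eqP /gap_gt0 gew.
move: sum_gap; apply/negP; rewrite -ltNge (bigD1 e) //= (bigD1 w) //=.
rewrite ltr_wpDr //.
  by apply: sumr_ge0 => e' _; apply: sumr_ge0 => w' _; exact: gap_ge0.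
by rewrite ltr_wpDr //; apply: sumr_ge0 => w' _; exact: gap_ge0.
Qed.

(** * Existence by compactness *)

(** Flows are encoded as row vectors indexed by pairs of a link and a type, where products of
    segments are compact and the extreme value theorem applies. *)
Let flow_of (v : 'rV[R]_#|{: link E * W}|) (e : link E) (w : W) : R :=
  v ord0 (enum_rank (e, w)).

Let flow_of_row (x : link E -> W -> R) :
  flow_of (\row_i x (enum_val i).1 (enum_val i).2) = x.
Proof.
by apply/funext => e; apply/funext => w; rewrite /flow_of mxE enum_rankK.
Qed.

Let flow_of_continuous e w : continuous (fun v => flow_of v e w).
Proof. exact: coord_continuous. Qed.

Let objective_continuous (A : set 'rV[R]_#|{: link E * W}|) :
  (forall v, A v -> forall e w, 0 <= flow_of v e w) ->
  {within A, continuous (fun v => TAP_objective q F t c (flow_of v))}.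
Proof.
move=> A0.
(* Truncating the arguments at 0 changes nothing on A and gives a function continuous on all row
   vectors. *)
pose Z v := \sum_e \sum_w (cumul e w (Num.max 0 (\sum_w q w * flow_of v e w))
  + q w * F e w (Num.max 0 (flow_of v e w))).
apply: (@subspace_eq_continuous _ _ _ Z).
  move=> v /set_mem /A0 v0; apply: eq_bigr => e _; apply: eq_bigr => w _.
  by rewrite !max_r // total_ge0.
apply: continuous_subspaceT; apply: continuous_sum => e.
have total_continuous :
    continuous (fun v : 'rV[R]_#|{: link E * W}| => \sum_w q w * flow_of v e w).
  by apply: continuous_linear_combination => w; exact: flow_of_continuous.
have term1 w : continuous (fun v : 'rV[R]_#|{: link E * W}| =>
    cumul e w (Num.max 0 (\sum_w q w * flow_of v e w))).
  move=> v; have := cumul_continuous e w (\sum_w q w * flow_of v e w).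
  exact: (cvg_comp _ _ (total_continuous v)).
have term2 w : continuous (fun v : 'rV[R]_#|{: link E * W}| =>
    q w * F e w (Num.max 0 (flow_of v e w))).
  apply: continuous_mull => v; have := perturbation_continuous e w (flow_of v e w).
  exact: (cvg_comp _ _ (flow_of_continuous e w v)).
apply: continuous_sum => w v.
exact: cvgD (term1 w v) (term2 w v).
Qed.

Let feasible_closed : closed [set v | forall u w,
  q w * (\sum_e incidence R u e * flow_of v e w - demand R (orig w) (dest w) u) = 0].
Proof.
have -> : [set v | forall u w, q w * (\sum_e incidence R u e * flow_of v e w -
    demand R (orig w) (dest w) u) = 0] =
  \bigcap_(i : V * W) ((fun v => q i.2 * (\sum_e incidence R i.1 e *
    flow_of v e i.2 - demand R (orig i.2) (dest i.2) i.1)) @^-1` [set 0]).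
  by apply/seteqP; split=> v /= h; [move=> i _; exact: h | move=> u w; exact: (h (u, w))].
apply: closed_bigI => -[u w] _ /=; apply: preimage_closed; last exact: closed_eq.
move=> v _; apply: continuous_mull => {}v.
apply: (@continuousB _ _ _ _ (cst (demand R (orig w) (dest w) u)));
  last exact: cst_continuous.
by apply: continuous_linear_combination => e; exact: flow_of_continuous.
Qed.

Lemma solution_exists :
  exists x : link E -> W -> R, TAP_solution q orig dest F t c x.
Proof.
have [x1 fx1] := exists_feasible; set M := TAP_objective q F t c x1.
have bound i : exists b : R, 0 <= b /\ F i.1 i.2 b = M / q i.2.
  have : nonnegR (M / q i.2).
    rewrite /nonnegR /= in_itv /= andbT divr_ge0 ?[0 <= q _]ltW //.
    apply: le_trans (term_le_objective _ i.1 i.2 fx1.1).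
    by rewrite mulr_ge0 ?perturbation_ge0 ?fx1.1 // ltW.
  rewrite -(perturbation_range (hF i.1 i.2)) => -[b b0 Fb]; exists b.
  by move: b0; rewrite /nonnegR /= in_itv /= andbT.
have [B BP] := choice bound.
(* Only flow conservation is imposed here; nonnegativity comes from [box]. *)
pose feas : set 'rV[R]_#|{: link E * W}| := [set v | forall u w,
  q w * (\sum_e incidence R u e * flow_of v e w - demand R (orig w) (dest w) u) = 0].
pose box : set 'rV[R]_#|{: link E * W}| :=
  [set v | forall i, v ord0 i \in `[0, B (enum_val i)]].
have cK : compact (box `&` feas).
  apply: compact_closedI => //.
  apply: (@rV_compact _ _ (fun i => [set` `[0, B (enum_val i)]])) => i.
  exact: segment_compact.
have sublevel y : TAP_feasible q orig dest y -> TAP_objective q F t c y <= M ->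
    (box `&` feas) (\row_i y (enum_val i).1 (enum_val i).2).
  move=> [y0 yA] yM; split; last by move=> u w /=; rewrite flow_of_row.
  move=> i /=; rewrite mxE in_itv /= y0 /=.
  have [b0 Fb] := BP (enum_val i); set e := (enum_val i).1 in Fb *.
  set w := (enum_val i).2 in Fb *; rewrite leNgt; apply/negP => By.
  (* A coordinate beyond its bound would make its own perturbation term exceed M. *)
  have : F e w (B (enum_val i)) < F e w (y e w).
    by apply: (perturbation_increasing (hF e w)); rewrite ?in_nonnegR.
  apply/negP; rewrite -leNgt Fb ler_pdivlMr // mulrC.
  exact: le_trans (term_le_objective _ e w y0) yM.
have [||v /set_mem [vbox vfeas] vmin] :=
    @EVT_min_rV _ _ (fun v => TAP_objective q F t c (flow_of v)) _ _ cK.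
- by eexists; exact: sublevel fx1 (lexx _).
- apply: objective_continuous => v [vbox _] e w.
  by have := vbox (enum_rank (e, w)); rewrite /= in_itv /= => /andP[].
exists (flow_of v); split.
  split=> // e w.
  by have := vbox (enum_rank (e, w)); rewrite /= in_itv /= => /andP[].
(* A competitor with objective above M is already beaten by [x1], which lies in the compact set. *)
move=> y fy; have [yM|/ltW My] := leP (TAP_objective q F t c y) M.
  by have := vmin _ (mem_set (sublevel y fy yM)); rewrite flow_of_row.
apply: le_trans My.
by have := vmin _ (mem_set (sublevel _ fx1 (lexx _))); rewrite flow_of_row.
Qed.

End TAP.

Theorem proposition2 (R : realType) (V W : finType) (E : {set V * V})
    (q : W -> R) (orig dest : W -> V)
    (F : link E -> W -> R -> R) (t : link E -> R -> R)
    (c : link E -> W -> R -> R)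
    (hE : connected_network E)
    (hq : forall w, 0 < q w)
    (hF : forall e w, perturbation_function (F e w))
    (ht : forall e, travel_time_function (t e))
    (hc : forall e w, link_cost_function (c e w)) :
  exists! x : link E -> W -> R, TAP_solution q orig dest F t c x.
Proof.
have [x sx] := @solution_exists _ _ _ _ _ orig dest _ _ _ hE hq hF ht hc.
by exists x; split=> // y sy; exact: (@solution_unique _ _ _ _ _ _ _ _ _ _ hq hF ht hc _ _ sx sy).
Qed.
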